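(* Let $K\subset\mathbb R^n$ be a convex polyhedral cone, $A:\mathbb R^n\to\mathbb R^n$ linear, and $\Phi(x)=Ax+N(K,x)$. If $\Phi$ is metrically regular near $(0,0)$, i.e. there are $\kappa>0,\varepsilon>0$ with $d(x,\Phi^{-1}(y))\le\kappa\,d(y,\Phi(x))$ whenever $\|x\|<\varepsilon$, $\|y\|<\varepsilon$, then $A(K)\cap K^\circ=\{0\}$.
   Context: A convex polyhedral cone is a finite intersection of closed half-spaces $\{x:\langle a,x\rangle\le0\}$. $N(C,x)=\{y:\langle y,u-x\rangle\le0\ \forall u\in C\}$ for $x\in C$ and $N(C,x)=\emptyset$ for $x\notin C$. $K^\circ=\{y:\langle y,x\rangle\le0\ \forall x\in K\}$. $d(\cdot,\emptyset)=+\infty$. *)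

(* Defs.v *)
From Stdlib Require Import Reals Lra ClassicalEpsilon.
From mathcomp Require Import ssreflect ssrfun ssrbool eqtype ssrnat fintype bigop.
Set Implicit Arguments.
Unset Strict Implicit.
Open Scope R_scope.

Definition vec (n : nat) := 'I_n -> R.
Definition vzero (n : nat) : vec n := fun _ => 0.
Definition vadd n (x y : vec n) : vec n := fun i => x i + y i.
Definition vsub n (x y : vec n) : vec n := fun i => x i - y i.
Definition dot n (x y : vec n) : R := \big[Rplus/0]_(i < n) (x i * y i).
Definition norm n (x : vec n) : R := sqrt (dot x x).

Definition matmul n (M : 'I_n -> 'I_n -> R) (x : vec n) : vec n :=
  fun i => \big[Rplus/0]_(j < n) (M i j * x j).

Definition polycone n m (a : 'I_m -> vec n) : vec n -> Prop :=
  fun x => forall j : 'I_m, dot (a j) x <= 0.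

Definition normal_cone n (C : vec n -> Prop) (x : vec n) : vec n -> Prop :=
  fun y => C x /\ forall u, C u -> dot y (vsub u x) <= 0.

Definition polar n (K : vec n -> Prop) : vec n -> Prop :=
  fun y => forall x, K x -> dot y x <= 0.

Definition Phi n (K : vec n -> Prop) (M : 'I_n -> 'I_n -> R) (x : vec n) : vec n -> Prop :=
  fun y => exists z, normal_cone K x z /\ y = vadd (matmul M x) z.

(* Extended nonnegative reals: None = +infinity *)
Definition ER := option R.
Definition er_le (a b : ER) : Prop :=
  match a, b with
  | _, None => True
  | None, Some _ => False
  | Some a, Some b => a <= b
  end.
Definition er_scale (k : R) (a : ER) : ER :=
  match a with None => None | Some a => Some (k * a) end.

(* Distance d(x,S) = inf_{s in S} ||x - s||, and d(x, empty) = +infinity *)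
Definition negdist_set n (x : vec n) (S : vec n -> Prop) : R -> Prop :=
  fun r => exists s, S s /\ r = - norm (vsub x s).

Lemma negdist_bound n (x : vec n) S : bound (negdist_set x S).
Proof.
exists 0; move=> r [s [_ ->]].
have := sqrt_pos (dot (vsub x s) (vsub x s)); rewrite /norm; lra.
Qed.

Lemma negdist_ex n (x : vec n) (S : vec n -> Prop) :
  (exists s, S s) -> exists r, negdist_set x S r.
Proof. by move=> [s Hs]; exists (- norm (vsub x s)), s. Qed.

Definition vdist n (x : vec n) (S : vec n -> Prop) : ER :=
  match excluded_middle_informative (exists s, S s) with
  | left H =>
      Some (- proj1_sig (completeness (negdist_set x S) (negdist_bound x S)
                                      (negdist_ex x H)))
  | right _ => None
  end.

(* Main.v *)
(** For [x] in [K] let [F] be the face of [K] having [x] in its relative interior and [S] its span. By homogeneity, regularity near the origin is global. Applying it near the base points [(0, y)] and [(x, M x + y)], with [y] in the relative interior of the normal cone of [F], forces the perturbed solutions to stay in [F]. This yields two facts: the compression of [M] to [S] is onto, hence injective; and for every [w] in [S] there is [h] in [F] with [M (w - h)] nonpositive on [F].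

Suppose that [M x] is nonpositive on [F]. If [F <> S], choose [w] in [S] outside [F] and [h] as above, and put [b := w - h]. Then [b] is outside [K], so the ray [x + t b] meets a proper face at a point [x'], where [M x'] is still nonpositive on the smaller face; by induction on faces [x' = 0]. So [M x] and [t M b] are nonpositive on [F] with sum zero, and [M x] vanishes on [F]. If [F = S] this holds because [F] is symmetric. By injectivity of the compression [x = 0]. *)
Require Import Defs.
From Stdlib Require Import Reals Lra ClassicalEpsilon Classical FunctionalExtensionality.
From mathcomp Require Import ssreflect ssrfun ssrbool eqtype ssrnat fintype bigop.
From mathcomp Require Import seq finset order ssralg ssrnum matrix mxalgebra Rstruct.
Import GRing.Theory.
Open Scope R_scope.

Set Implicit Arguments.
Unset Strict Implicit.

(** * Inner product, norm bounds and linear maps *)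

Definition vscale {n} (t : R) (x : vec n) : vec n := fun i => t * x i.

Section Vectors.
Variable n : nat.
Implicit Types x y z u : vec n.

Lemma dotC x y : dot x y = dot y x.
Proof. by apply: eq_bigr => i _; rewrite Rmult_comm. Qed.

Lemma dot_addl x y z : dot (vadd x y) z = dot x z + dot y z.
Proof.
by rewrite /dot -big_split; apply: eq_bigr => i _; rewrite /vadd /=; ring.
Qed.

Lemma dot_scalel t x z : dot (vscale t x) z = t * dot x z.
Proof.
by rewrite /dot big_distrr; apply: eq_bigr => i _; rewrite /vscale /=; ring.
Qed.

Lemma vsubE x y : vsub x y = vadd x (vscale (-1) y).
Proof.
by apply: functional_extensionality => i; rewrite /vsub /vadd /vscale; ring.
Qed.

Lemma dot_subl x y z : dot (vsub x y) z = dot x z - dot y z.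
Proof. by rewrite vsubE dot_addl dot_scalel; ring. Qed.

Lemma dot_addr x y z : dot z (vadd x y) = dot z x + dot z y.
Proof. by rewrite dotC dot_addl !(dotC z). Qed.

Lemma dot_scaler t x z : dot z (vscale t x) = t * dot z x.
Proof. by rewrite dotC dot_scalel (dotC z). Qed.

Lemma dot_subr x y z : dot z (vsub x y) = dot z x - dot z y.
Proof. by rewrite dotC dot_subl !(dotC z). Qed.

Lemma dot0l z : dot (@vzero n) z = 0.
Proof. by rewrite /dot big1 // => i _; rewrite /vzero Rmult_0_l. Qed.

Lemma dot0r z : dot z (@vzero n) = 0.
Proof. by rewrite dotC dot0l. Qed.

Lemma sum_ge0 k (P : pred 'I_k) (f : 'I_k -> R) :
  (forall i, 0 <= f i) -> 0 <= \big[Rplus/0]_(i < k | P i) f i.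
Proof.
move=> f0; apply: (big_ind (fun r => 0 <= r)) => [|r s r0 s0|i _]; first lra.
  lra.
exact: f0.
Qed.

Lemma dot_ge0 x : 0 <= dot x x.
Proof. by apply: sum_ge0 => i; apply: Rle_0_sqr. Qed.

Lemma norm_ge0 x : 0 <= norm x.
Proof. exact: sqrt_pos. Qed.

Lemma norm_scale t x : norm (vscale t x) = Rabs t * norm x.
Proof.
rewrite /norm dot_scalel dot_scaler -Rmult_assoc sqrt_mult.
- by rewrite -[in RHS]sqrt_Rsqr_abs.
- exact: Rle_0_sqr.
- exact: dot_ge0.
Qed.

Lemma coord_le_norm x i : Rabs (x i) <= norm x.
Proof.
rewrite -sqrt_Rsqr_abs; apply: sqrt_le_1_alt.
rewrite /dot (bigD1 i) //= /Rsqr.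
rewrite -[X in X <= _]Rplus_0_r; apply: Rplus_le_compat_l.
by apply: sum_ge0 => j; apply: Rle_0_sqr.
Qed.

Lemma dot_bound x :
  exists2 B, 0 < B & forall y, Rabs (dot x y) <= B * norm y.
Proof.
(* The sum alone already bounds; the added 1 makes the constant positive, so that it can be divided
   by. *)
exists (1 + \big[Rplus/0]_(i < n) Rabs (x i)).
  suff : 0 <= \big[Rplus/0]_(i < n) Rabs (x i) by lra.
  by apply: sum_ge0 => i; apply: Rabs_pos.
move=> y; suff : Rabs (dot x y) <= (\big[Rplus/0]_(i < n) Rabs (x i)) * norm y.
  by have := norm_ge0 y; lra.
rewrite /dot big_distrl /=.
apply: (big_rec2 (fun r s => Rabs r <= s)) => [|i r s _ rs].
  by rewrite Rabs_R0; lra.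
apply: Rle_trans (Rabs_triang _ _) _; rewrite Rabs_mult.
apply: Rplus_le_compat rs.
exact: Rmult_le_compat_l _ _ _ (Rabs_pos (x i)) (coord_le_norm y i).
Qed.

Variable M : 'I_n -> 'I_n -> R.

Lemma matmul_add x y : matmul M (vadd x y) = vadd (matmul M x) (matmul M y).
Proof.
by apply: functional_extensionality => i; apply: (dot_addr x y (M i)).
Qed.

Lemma matmul_scale t x : matmul M (vscale t x) = vscale t (matmul M x).
Proof.
by apply: functional_extensionality => i; apply: (dot_scaler t x (M i)).
Qed.

Lemma matmul_sub x y : matmul M (vsub x y) = vsub (matmul M x) (matmul M y).
Proof.
by apply: functional_extensionality => i; apply: (dot_subr x y (M i)).
Qed.

Lemma matmul0 : matmul M (@vzero n) = @vzero n.
Proof.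
by apply: functional_extensionality => i; apply: (dot0r (M i)).
Qed.

(** Moving [M] to the other side as its transpose reduces this to [dot_bound] for a fixed vector. *)
Lemma dot_matmul_bound z :
  exists2 B, 0 < B & forall x, Rabs (dot (matmul M x) z) <= B * norm x.
Proof.
have [B B0 HB] := dot_bound (fun j => \big[Rplus/0]_(i < n) (z i * M i j)).
exists B => // x.
suff -> : dot (matmul M x) z =
    dot (fun j => \big[Rplus/0]_(i < n) (z i * M i j)) x by [].
rewrite dotC /dot /matmul.
under eq_bigr => i _ do rewrite big_distrr.
rewrite exchange_big /=; apply: eq_bigr => j _.
by rewrite big_distrl /=; apply: eq_bigr => i _; ring.
Qed.

(* In the basis [B] of [S], compressing [M] to [S] gives a square matrix [G]; onto means that [G] has full rank, hence is invertible. *)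
Lemma compression_surj_inj m (c : 'I_m -> vec n) (S : vec n -> Prop) :
  (forall u, S u <-> forall i, dot (c i) u = 0) ->
  (forall z, exists h, S h /\
     forall u, S u -> dot (vsub z (matmul M h)) u = 0) ->
  forall x, S x -> (forall u, S u -> dot (matmul M x) u = 0) -> x = @vzero n.
Proof.
move=> HS surj.
pose row_of (u : vec n) : 'rV[R]_n := (\row_i u i)%R.
pose vec_of (r : 'rV[R]_n) : vec n := r ord0.
have rowK r : row_of (vec_of r) = r.
  by apply/rowP => i; rewrite mxE.
have row_dot u v : ((row_of u *m (row_of v)^T) ord0 ord0 = dot u v)%R.
  by rewrite mxE; apply: eq_bigr => i _; rewrite !mxE.
(* Vectors become rows acting from the left, so [M] is transposed. *)
pose N : 'M[R]_n := (\matrix_(i, j) M j i)%R.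
have row_matmul u : row_of (matmul M u) = (row_of u *m N)%R.
  apply/rowP => i; rewrite !mxE; apply: eq_bigr => j _.
  by rewrite !mxE /= mulrC.
pose C : 'M[R]_(n, m) := (\matrix_(k, i) c i k)%R.
have Bfree := row_base_free (kermx C).
pose B := row_base (kermx C).
have SB u : S u <-> exists w, row_of u = (w *m B)%R.
  transitivity (row_of u *m C = 0)%R.
    rewrite HS; split => [u0|u0 i].
      apply/rowP => i; rewrite !mxE -[RHS](u0 i); apply: eq_bigr => k _.
      by rewrite !mxE mulrC.
    move/rowP: u0 => /(_ i); rewrite !mxE => u0.
    rewrite -[RHS]u0; apply: eq_bigr => k _.
    by rewrite !mxE mulrC.
  split=> [/sub_kermxP|[w ew]].
    by rewrite -(eq_row_base (kermx C)) => /submxP.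
  by apply/sub_kermxP; rewrite -(eq_row_base (kermx C)) ew submxMl.
rewrite -/B in Bfree.
clearbody B.
have orth (r : 'rV[R]_n) : (forall u, S u -> dot (vec_of r) u = 0) ->
    (r *m B^T = 0)%R.
  move=> r0; apply/rowP => j; rewrite [RHS]mxE.
  have Sj : S (vec_of (row j B)).
    by apply/SB; exists (delta_mx ord0 j); rewrite rowK rowE.
  rewrite -[RHS](r0 _ Sj) -row_dot !rowK.
  by rewrite !mxE; apply: eq_bigr => k _; rewrite !mxE.
pose G := (B *m N *m B^T)%R.
have Gfull : row_full G.
  rewrite -sub1mx; apply/row_subP => i; move: (row i _) => w.
  have BTfull : row_full (B^T)%R.
    by rewrite /row_full mxrank_tr; exact: Bfree.
  (* Since [B^T] has full rank, any [w] is [z *m B^T] for some row [z]; compressed surjectivity at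
     this [z] writes [w] as [g *m G]. *)
  have [h [/SB [g hg] hz]] := surj (vec_of (w *m pinvmx (B^T)%R)%R).
  apply/submxP; exists g.
  have := orth (w *m pinvmx (B^T)%R - g *m B *m N)%R.
  rewrite mulmxBl mulmxKpV ?submx_full // => z0.
  apply/eqP; rewrite -subr_eq0 /G !mulmxA; apply/eqP. apply: z0 => u Su.
  rewrite -[RHS](hz u Su); congr (dot _ u).
  apply: functional_extensionality => j.
  by rewrite /vsub /vec_of -hg -row_matmul !mxE.
have Gunit : G \in unitmx by rewrite -row_full_unit.
move=> x /SB [w xw] Mx.
have w0 : w = 0%R.
  rewrite -[w](mulmxK Gunit) /G !mulmxA -xw -row_matmul orth ?mul0mx //.
    by move=> u Su; rewrite -[RHS](Mx u Su) -!row_dot rowK.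
apply: functional_extensionality => i.
move/rowP: xw => /(_ i); rewrite w0 mul0mx !mxE => ->.
by [].
Qed.

End Vectors.

(** * Distances to sets, the graph of [Phi], and finiteness arguments *)

Lemma vdist_le n (x s : vec n) (S : vec n -> Prop) :
  S s -> exists2 d, vdist x S = Some d & d <= norm (vsub x s).
Proof.
move=> Ss; rewrite /vdist; case: excluded_middle_informative => [H|[]].
  case: completeness => b [ub _] /=; exists (- b) => //.
  have : - norm (vsub x s) <= b by apply: ub; exists s.
  by lra.
by exists s.
Qed.

Lemma vdist_approx n (x : vec n) (S : vec n -> Prop) d r :
  vdist x S = Some d -> d < r -> exists2 s, S s & norm (vsub x s) < r.
Proof.
rewrite /vdist; case: excluded_middle_informative => [H|//].
case: completeness => b [_ lub] /= [<-] br; apply: NNPP => noS.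
suff : b <= - r by lra.
apply: lub => _ [s [Ss ->]].
suff : r <= norm (vsub x s) by lra.
by apply: Rnot_lt_le => sr; apply: noS; exists s.
Qed.

Lemma PhiE n (K : vec n -> Prop) M x y :
  Phi K M x y <-> normal_cone K x (vsub y (matmul M x)).
Proof.
split=> [[z [Nz ->]]|N].
  suff -> : vsub (vadd (matmul M x) z) (matmul M x) = z by [].
  by apply: functional_extensionality => i; rewrite /vsub /vadd; ring.
exists (vsub y (matmul M x)); split => //.
by apply: functional_extensionality => i; rewrite /vsub /vadd; ring.
Qed.

Lemma small_scale n eps (x y : vec n) : 0 < eps ->
  exists t, [/\ 0 < t, norm (vscale t x) < eps & norm (vscale t y) < eps].
Proof.
move=> eps0; have nx := norm_ge0 x; have ny := norm_ge0 y.
pose c := 1 + norm x + norm y; have c0 : 0 < c by rewrite /c; lra.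
have t0 : 0 < eps / c by apply: Rdiv_lt_0_compat.
have E : eps / c * (1 + norm x + norm y) = eps by rewrite -/c; field; lra.
by exists (eps / c); split=> //; rewrite norm_scale Rabs_pos_eq; nra.
Qed.

Lemma finite_uniform (T : finType) (P : T -> R -> Prop) :
  (forall i, exists2 eta, 0 < eta & forall r, r < eta -> P i r) ->
  exists2 eta, 0 < eta & forall i r, r < eta -> P i r.
Proof.
move=> HP.
have : exists2 eta, 0 < eta & forall i, i \in enum T -> forall r, r < eta -> P i r.
  elim: (enum T) => [|i s [eta eta0 IH]]; first by exists 1 => //; lra.
  have [e e0 He] := HP i.
  exists (Rmin eta e) => [|j]; first exact: Rmin_glb_lt.
  rewrite inE => /orP[/eqP ->|js] r hr.
    by apply: He; apply: Rlt_le_trans hr (Rmin_r _ _).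
  by apply: IH => //; apply: Rlt_le_trans hr (Rmin_l _ _).
by case=> eta eta0 H; exists eta => // i; apply: H; rewrite mem_enum.
Qed.

(** If each index failed below its own threshold, all would fail below a common one. *)
Lemma finite_pigeonhole (T : finType) (P : T -> R -> Prop) :
  (forall r, 0 < r -> exists i, P i r) ->
  exists i, forall eta, 0 < eta -> exists r, [/\ 0 < r, r < eta & P i r].
Proof.
move=> HP; apply: NNPP => no.
have [|eta eta0 H] := @finite_uniform T (fun i r => 0 < r -> ~ P i r).
  move=> i; apply: NNPP => noi; apply: no; exists i => eta eta0.
  apply: NNPP => noeta; apply: noi; exists eta => // r reta r0 Pr.
  by apply: noeta; exists r.
have [i Pi] := HP (eta / 2) ltac:(lra).
by apply: (H i (eta / 2)) => //; lra.
Qed.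

Lemma finite_min (T : finType) (P : pred T) (f : T -> R) i0 :
  P i0 -> exists2 i, P i & forall j, P j -> f i <= f j.
Proof.
move=> Pi0; have [i Pi Hi] := Order.TotalTheory.arg_minP f Pi0.
by exists i => // j Pj; apply/RleP/Hi.
Qed.

(** * Faces and normal cones of a polyhedral cone *)

Section PolyhedralCone.
Variables (n m : nat) (a : 'I_m -> vec n).
Local Notation K := (polycone a).
Implicit Types x y z u d : vec n.

Lemma polycone0 : K (@vzero n).
Proof. by move=> i; rewrite dot0r; lra. Qed.

Lemma polycone_add x y : K x -> K y -> K (vadd x y).
Proof. by move=> Kx Ky i; rewrite dot_addr; have := Kx i; have := Ky i; lra. Qed.

Lemma polycone_scale t x : 0 <= t -> K x -> K (vscale t x).
Proof. by move=> t0 Kx i; rewrite dot_scaler; have := Kx i; nra. Qed.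

(** Testing normality at [0] and at [x + x] gives both signs of [dot y x]. *)
Lemma normal_coneP x y :
  normal_cone K x y <-> [/\ K x, dot y x = 0 & polar K y].
Proof.
split=> [[Kx Ny]|[Kx yx Py]]; last first.
  by split=> // u Ku; rewrite dot_subr yx; have := Py u Ku; lra.
have yx : dot y x = 0.
  have := Ny _ polycone0; have := Ny _ (polycone_add Kx Kx).
  by rewrite !(dot_subr, dot_addr) dot0r; lra.
by split=> // u Ku; have := Ny u Ku; rewrite dot_subr yx; lra.
Qed.

Lemma normal_cone_scale t x y : 0 < t ->
  normal_cone K x y -> normal_cone K (vscale t x) (vscale t y).
Proof.
move=> t0 /normal_coneP[Kx yx Py]; apply/normal_coneP; split.
- by apply: polycone_scale => //; lra.
- by rewrite dot_scalel dot_scaler yx; ring.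
- by move=> u Ku; rewrite dot_scalel; have := Py u Ku; nra.
Qed.

Lemma Phi_scale M t x y : 0 < t -> Phi K M x y -> Phi K M (vscale t x) (vscale t y).
Proof.
move=> t0 /PhiE/(normal_cone_scale t0) N; apply/PhiE.
rewrite matmul_scale.
suff <- : vscale t (vsub y (matmul M x)) = vsub (vscale t y) (vscale t (matmul M x)).
  by [].
by apply: functional_extensionality => i; rewrite /vsub /vscale; ring.
Qed.

(** This encodes faces: for [x] in [K], [active x \subset active u] says that [u] lies in the span
    of the smallest face containing [x]; together with [K u] it says that [u] lies in that face. *)
Definition active x : {set 'I_m} := [set i | dot (a i) x == 0].

Lemma activeP x i : reflect (dot (a i) x = 0) (i \in active x).
Proof. by rewrite inE; apply: eqP. Qed.

Lemma active_add (J : {set 'I_m}) x y :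
  J \subset active x -> J \subset active y -> J \subset active (vadd x y).
Proof.
move=> /subsetP Jx /subsetP Jy; apply/subsetP => i iJ; apply/activeP.
by rewrite dot_addr (activeP _ _ (Jx i iJ)) (activeP _ _ (Jy i iJ)); ring.
Qed.

Lemma active_scale (J : {set 'I_m}) t x :
  J \subset active x -> J \subset active (vscale t x).
Proof.
move=> /subsetP Jx; apply/subsetP => i iJ; apply/activeP.
by rewrite dot_scaler (activeP _ _ (Jx i iJ)); ring.
Qed.

Lemma active_sub (J : {set 'I_m}) x y :
  J \subset active x -> J \subset active y -> J \subset active (vsub x y).
Proof. by move=> Jx Jy; rewrite vsubE; apply: active_add => //; apply: active_scale. Qed.

(** Constraints inactive at [x] are strict and survive small moves; active ones stay zero along
    [d]. *)
Lemma polycone_near x : K x -> exists2 eta, 0 < eta &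
  forall d, norm d < eta -> active x \subset active d ->
    K (vadd x d) /\ active (vadd x d) \subset active x.
Proof.
move=> Kx.
have [|eta eta0 H] := @finite_uniform 'I_m (fun i r => forall d, norm d <= r ->
    i \notin active x -> dot (a i) (vadd x d) < 0).
  move=> i; case: (boolP (i \in active x)) => [_|/activeP ix].
    by exists 1 => //; lra.
  have {ix} ix : dot (a i) x < 0 by have := Kx i; lra.
  have [B B0 HB] := dot_bound (a i).
  exists (- dot (a i) x / B) => [|r rB d dr _].
    by apply: Rdiv_lt_0_compat => //; lra.
  have E : - dot (a i) x / B * B = - dot (a i) x by field; lra.
  rewrite dot_addr; have := Rle_abs (dot (a i) d); have := HB d; nra.
exists eta => // d deta /subsetP xd; split=> [i|].
  case: (boolP (i \in active x)) => ix; last by apply: Rlt_le; apply: H deta _ _ _ => //; lra.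
  by rewrite dot_addr (activeP _ _ ix) (activeP _ _ (xd i ix)); lra.
apply/subsetP => i /activeP ixd; apply: contraT => ix.
by have := H i _ deta d (Rle_refl _) ix; lra.
Qed.

Lemma polycone_move x u : K x -> active x \subset active u ->
  exists2 s, 0 < s & K (vadd x (vscale s u)).
Proof.
move=> Kx xu; have [eta eta0 H] := polycone_near Kx.
have [s [s0 su _]] := small_scale u u eta0.
by exists s => //; case: (H _ su) => //; apply: active_scale.
Qed.

(** From [x] one can move a little along both [u] and [-u] without leaving [K]. *)
Lemma normal_cone_orth x y u : normal_cone K x y -> active x \subset active u ->
  dot y u = 0.
Proof.
move=> /normal_coneP[Kx yx Py] xu.
have half v : active x \subset active v -> dot y v <= 0.
  move=> xv; have [s s0 Ks] := polycone_move Kx xv.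
  by have := Py _ Ks; rewrite dot_addr dot_scaler yx; nra.
by have := half _ xu; have := half _ (active_scale (-1) xu); rewrite dot_scaler; lra.
Qed.

(* The sum of the normals indexed by [J] lies in the relative interior of the normal cone of the face defined by [J]. *)
Lemma exposing_normal (J : {set 'I_m}) : exists y,
  [/\ forall u, J \subset active u -> dot y u = 0, polar K y &
      forall u, K u -> dot y u = 0 -> J \subset active u].
Proof.
exists (fun k => \big[Rplus/0]_(i in J) a i k).
have E u : dot (fun k => \big[Rplus/0]_(i in J) a i k) u =
    \big[Rplus/0]_(i in J) dot (a i) u.
  by rewrite /dot exchange_big /=; apply: eq_bigr => k _; rewrite big_distrl.
have le0 (P : pred 'I_m) u : K u -> \big[Rplus/0]_(i | P i) dot (a i) u <= 0.
  move=> Ku; apply: (big_ind (fun r => r <= 0)) => [|r s r0 s0|i _]; first lra.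
    by rewrite -[0]Rplus_0_r; apply: Rplus_le_compat.
  exact: Ku.
split=> [u /subsetP Ju|u Ku|u Ku]; rewrite E.
- by apply: big1 => i iJ; apply/activeP/Ju.
- exact: le0.
- move=> u0; apply/subsetP => i iJ; apply/activeP.
  have := Ku i; have := le0 (fun j => (j \in J) && (j != i)) u Ku.
  rewrite (bigD1 i) //= in u0.
  move: (dot (a i) u) (\big[Rplus/0]_(j | _) _) u0 => r s.
  change (r + s = 0 -> s <= 0 -> r <= 0 -> r = 0).
  lra.
Qed.

(** Ratio test: stop at the first constraint that becomes tight among those increasing along [b]. It
    is newly active, because constraints active at [x] vanish on [b]. *)
Lemma polycone_exit x b : K x -> active x \subset active b -> ~ K b ->
  exists2 t, 0 <= t & K (vadd x (vscale t b)) /\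
    active x \proper active (vadd x (vscale t b)).
Proof.
move=> Kx xb nKb.
pose P i := ~~ (dot (a i) b <= 0)%R.
have [i0 Pi0] : exists i, P i.
  apply: NNPP => noP; apply: nKb => i; apply/RleP; apply: contraT => Pi.
  by case: noP; exists i.
have Ppos i : P i -> 0 < dot (a i) b by move=> /RleP/Rnot_le_lt.
have [j Pj minj] := @finite_min _ P (fun i => - dot (a i) x / dot (a i) b) _ Pi0.
have j0 := Ppos j Pj; move: minj.
set t := _ / dot (a j) b => minj.
have tj : t * dot (a j) b = - dot (a j) x by rewrite /t; field; lra.
have t0 : 0 <= t by have := Kx j; nra.
exists t => //; split=> [i|].
  rewrite dot_addr dot_scaler; case: (boolP (P i)) => Pi.
    have ib := Ppos i Pi.
    have := Rmult_le_compat_r _ _ _ (Rlt_le _ _ ib) (minj i Pi).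
    have -> : - dot (a i) x / dot (a i) b * dot (a i) b = - dot (a i) x by field; lra.
    by lra.
  move: Pi; rewrite negbK => /RleP bi; have {}bi : dot (a i) b <= 0 := bi.
  by have := Kx i; nra.
rewrite properE active_add ?active_scale //=.
apply/subsetPn; exists j.
  by apply/activeP; rewrite dot_addr dot_scaler tj; ring.
apply/negP => jx; have /activeP := subsetP xb _ jx; lra.
Qed.

End PolyhedralCone.

(** * From regularity near the origin to a global estimate *)

Definition lipschitz_regular n (K : vec n -> Prop) (M : 'I_n -> 'I_n -> R) kappa :=
  forall p q w r, Phi K M p q -> kappa * norm w < r ->
  exists2 p', Phi K M p' (vadd q w) & norm (vsub p' p) < r.

Lemma vscaleA n s t (x : vec n) : vscale s (vscale t x) = vscale (s * t) x.
Proof. by apply: functional_extensionality => i; rewrite /vscale; ring. Qed.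

Lemma vscale1 n (x : vec n) : vscale 1 x = x.
Proof. by apply: functional_extensionality => i; rewrite /vscale; ring. Qed.

(* [Phi] is positively homogeneous, so an estimate near the origin holds everywhere. *)
Lemma regular_homogeneous n m (a : 'I_m -> vec n) M kappa eps :
  0 < kappa -> 0 < eps ->
  (forall x y : vec n, norm x < eps -> norm y < eps ->
     er_le (vdist x (fun u => Phi (polycone a) M u y))
           (er_scale kappa (vdist y (Phi (polycone a) M x)))) ->
  lipschitz_regular (polycone a) M kappa.
Proof.
move=> kappa0 eps0 reg p q w r pq wr.
have [t [t0 tp tq]] := small_scale p (vadd q w) eps0.
have := reg _ _ tp tq.
have [d -> dw] := vdist_le (vscale t (vadd q w)) (Phi_scale t0 pq).
have {}dw : d <= t * norm w.
  have <- : norm (vscale t w) = t * norm w.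
    by rewrite norm_scale Rabs_pos_eq //; lra.
  suff <- : vsub (vscale t (vadd q w)) (vscale t q) = vscale t w by [].
  by apply: functional_extensionality => i; rewrite /vsub /vscale /vadd; ring.
case E : vdist => [d'|//] /= d'd.
have d'r : d' < t * r by nra.
(* The strict bound yields an actual solution without knowing that the infimum is attained. *)
have [s Phis sr] := vdist_approx E d'r.
have it0 := Rinv_0_lt_compat _ t0.
have tt : / t * t = 1 by field; lra.
exists (vscale (/ t) s).
  by have := Phi_scale it0 Phis; rewrite vscaleA tt vscale1.
have -> : vsub (vscale (/ t) s) p = vscale (- / t) (vsub (vscale t p) s).
  by apply: functional_extensionality => i; rewrite /vsub /vscale; field; lra.
rewrite norm_scale Rabs_Ropp Rabs_pos_eq; last lra.
have -> : r = / t * (t * r) by field; lra.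
exact: Rmult_lt_compat_l.
Qed.

(** * Consequences of regularity on each face, and induction on faces *)

Section RegularCone.
Variables (n m : nat) (a : 'I_m -> vec n) (M : 'I_n -> 'I_n -> R) (kappa : R).
Hypothesis kappa_gt0 : 0 < kappa.
Hypothesis regular : lipschitz_regular (polycone a) M kappa.
Local Notation K := (polycone a).

(* Some active set recurs for arbitrarily small [r]; points with the same active set have the same normal cone, so [y] is a limit of normals at the chosen point [vadd p d]. *)
Lemma perturbed_solution p y z eta : normal_cone K p y -> 0 < eta ->
  exists r d, [/\ 0 < r, r < eta, norm d < r,
    normal_cone K (vadd p d)
      (vsub (vadd y (vscale (r / (kappa * norm z + 1)) z)) (matmul M d)) &
    dot y (vadd p d) = 0].
Proof.
(* This [c] makes [kappa] times the norm of [(r / c) z] strictly less than [r], also when [z] is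
   zero. *)
move=> Ny eta0; set c := kappa * norm z + 1.
have nz0 := norm_ge0 z; have c0 : 0 < c by rewrite /c; nra.
pose sol r d := norm d < r /\
  normal_cone K (vadd p d) (vsub (vadd y (vscale (r / c) z)) (matmul M d)).
have [r r0|J recJ] := @finite_pigeonhole _ (fun (J : {set 'I_m}) r =>
    exists2 d, sol r d & active a (vadd p d) = J).
  suff [d sd] : exists d, sol r d by exists (active a (vadd p d)), d.
  have Pp : Phi K M p (vadd (matmul M p) y) by exists y.
  have rc : 0 < r / c by apply: Rdiv_lt_0_compat.
  have [|p' /PhiE Np' p'r] := regular (w := vscale (r / c) z) (r := r) Pp.
    rewrite norm_scale Rabs_pos_eq; last lra.
    have E : r / c * (kappa * norm z + 1) = r by rewrite -/c; field; lra.
    by nra.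
  exists (vsub p' p); split => //.
  have -> : vadd p (vsub p' p) = p'.
    by apply: functional_extensionality => i; rewrite /vadd /vsub; ring.
  rewrite matmul_sub.
  suff <- : vsub (vadd (vadd (matmul M p) y) (vscale (r / c) z)) (matmul M p') =
      vsub (vadd y (vscale (r / c) z)) (vsub (matmul M p') (matmul M p)) by [].
  by apply: functional_extensionality => i; rewrite /vadd /vsub; ring.
have [r [r0 reta [d [dr Nd] aJ]]] := recJ eta eta0.
exists r, d; split=> //; move: (vadd p d) aJ => h aJ.
have [B B0 HB] := dot_matmul_bound M h.
set e := dot y h; set f := dot z h.
have bound r' : 0 < r' -> exists s, [/\ 0 < s, s < r' & Rabs e <= s * (Rabs f / c + B)].
  move=> r'0; have [s [s0 sr' [d' [d's Nd'] aJ']]] := recJ r' r'0.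
  exists s; split=> //.
  (* The normal at [vadd p d'] is also orthogonal to [h], as both points have active set [J]. *)
  have := normal_cone_orth (u := h) Nd'; rewrite aJ aJ' => /(_ (subxx _)).
  rewrite dot_subl dot_addl dot_scalel -/e -/f => E.
  have -> : e = dot (matmul M d') h - s / c * f by lra.
  have := Rabs_triang (dot (matmul M d') h) (- (s / c * f)).
  rewrite Rabs_Ropp Rabs_mult [Rabs (s / c)]Rabs_pos_eq.
    have := HB d'.
    have -> : s / c * Rabs f = s * (Rabs f / c) by field; lra.
    by rewrite /Rminus; nra.
  by apply/Rlt_le/Rdiv_lt_0_compat.
(* A nonzero [e] would contradict the bound, whose right side tends to 0 with [s]. *)
case: (Req_dec e 0) => // ne; have e0 := Rabs_pos_lt _ ne.
set D := Rabs f / c + B in bound.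
have D0 : 0 < D.
  have : 0 <= Rabs f / c by apply: Rle_mult_inv_pos => //; apply: Rabs_pos.
  by rewrite /D; lra.
have [|s [s0 sD]] := bound (Rabs e / D); first exact: Rdiv_lt_0_compat.
have E : Rabs e / D * D = Rabs e by field; lra.
by nra.
Qed.

(** Perturb at the base point [0] with the exposing normal [y] of the face. Then [dot y d = 0] puts
    [d] in the face, and [y] drops out when tested there; rescaling [d] by [c / r] gives [h]. *)
Lemma face_surjective x z : K x -> exists h,
  [/\ K h, active a x \subset active a h &
      forall u, K u -> active a x \subset active a u ->
        dot (vsub z (matmul M h)) u <= 0].
Proof.
move=> Kx; have [y [y0 Py yexp]] := exposing_normal a (active a x).
have Ny : normal_cone K (@vzero n) y.
  by apply/normal_coneP; split=> //; [apply: polycone0|apply: dot0r].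
have [r [d [r0 _ _]]] := perturbed_solution z Ny Rlt_0_1.
have -> : vadd (@vzero n) d = d.
  by apply: functional_extensionality => i; rewrite /vadd /vzero; ring.
set c := kappa * norm z + 1.
have nz0 := norm_ge0 z; have c0 : 0 < c by rewrite /c; nra.
have rc : 0 < r / c by apply: Rdiv_lt_0_compat.
have cr : 0 < c / r by apply: Rdiv_lt_0_compat.
move=> /normal_coneP[Kd _ Pd] yd; exists (vscale (c / r) d); split.
- by apply: polycone_scale => //; lra.
- exact/active_scale/yexp.
- move=> u Ku xu; have := Pd u Ku.
  rewrite matmul_scale !dot_subl dot_addl !dot_scalel y0 // => ineq.
  have := Rmult_le_compat_l _ _ _ (Rlt_le _ _ cr) ineq.
  have -> : c / r * (0 + r / c * dot z u - dot (matmul M d) u) =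
      dot z u - c / r * dot (matmul M d) u by field; lra.
  by lra.
Qed.

(** Perturbing at [x] instead turns the inequality into an equality: a small [d] activates no
    constraint beyond those of [x], so the perturbed normal is orthogonal to the whole span of the
    face. *)
Lemma span_face_surjective x z : K x -> exists h,
  active a x \subset active a h /\
  forall u, active a x \subset active a u -> dot (vsub z (matmul M h)) u = 0.
Proof.
move=> Kx; have [y [y0 Py yexp]] := exposing_normal a (active a x).
have Ny : normal_cone K x y by apply/normal_coneP; split=> //; apply: y0.
have [eta eta0 near] := polycone_near Kx.
have [r [d [r0 reta dr]]] := perturbed_solution z Ny eta0.
set c := kappa * norm z + 1.
have nz0 := norm_ge0 z; have c0 : 0 < c by rewrite /c; nra.
move=> N yd.
have [Kxd _ _] := (normal_coneP _ _ _).1 N.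
have xd : active a x \subset active a d.
  have -> : d = vsub (vadd x d) x.
    by apply: functional_extensionality => i; rewrite /vsub /vadd; ring.
  by apply: active_sub => //; apply: yexp.
exists (vscale (c / r) d); split=> [|u xu]; first exact: active_scale.
have [_ sub] := near d (Rlt_trans _ _ _ dr reta) xd.
have := normal_cone_orth N (subset_trans sub xu).
rewrite matmul_scale !dot_subl dot_addl !dot_scalel y0 // => E.
have -> : dot (matmul M d) u = r / c * dot z u by lra.
by field; lra.
Qed.

Lemma span_face_injective x : K x ->
  (forall u, active a x \subset active a u -> dot (matmul M x) u = 0) ->
  x = @vzero n.
Proof.
move=> Kx Mx.
(* Zeroing the inactive rows presents the span of the face as a kernel. *)
pose c i : vec n := if i \in active a x then a i else @vzero n.
apply: (@compression_surj_inj _ M _ c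
  (fun u => active a x \subset active a u)) => // [u|z]; last first.
  exact: span_face_surjective.
split=> [/subsetP xu i|cu].
  by rewrite /c; case: ifP => [/xu/activeP //|_]; apply: dot0l.
by apply/subsetP => i ix; apply/activeP; have := cu i; rewrite /c ix.
Qed.

Lemma copositive_face_trivial x : K x ->
  (forall u, K u -> active a x \subset active a u -> dot (matmul M x) u <= 0) ->
  x = @vzero n.
Proof.
(* Induction on the number of inactive constraints, which drops on passing to a proper face. *)
have [k] := ubnP #|~: active a x|; elim: k x => // k IH x xk Kx Mx.
suff Mx0 u : K u -> active a x \subset active a u -> dot (matmul M x) u = 0.
  (* Vanishing on the face suffices: for [u] in its span, [x + s u] lies in the face for some
     positive [s]. *)
  apply: span_face_injective => // u xu.
  have [s s0 Ks] := polycone_move Kx xu.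
  have := Mx0 _ Ks (active_add (subxx _) (active_scale _ xu)).
  by rewrite dot_addr dot_scaler Mx0 //; nra.
move=> Ku xu.
case: (classic (K (vscale (-1) u))) => [Kmu|nKmu].
  have := Mx _ Kmu (active_scale _ xu); have := Mx _ Ku xu.
  by rewrite dot_scaler; lra.
(* Here [-u] serves as a vector of the span lying outside the face. *)
have xw := active_scale (-1) xu; move: (vscale (-1) u) xw nKmu => w xw nKw.
have [h [Kh xh Mh]] := face_surjective (matmul M w) Kx.
pose b := vsub w h.
have nKb : ~ K b.
  move=> Kb; apply: nKw; have -> : w = vadd b h.
    by apply: functional_extensionality => i; rewrite /b /vsub /vadd; ring.
  exact: polycone_add.
have Mb v : K v -> active a x \subset active a v -> dot (matmul M b) v <= 0.
  by move=> Kv xv; rewrite /b matmul_sub; apply: Mh.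
have [t t0 [Kx' xx']] := polycone_exit Kx (active_sub xw xh) nKb.
have x'0 : vadd x (vscale t b) = @vzero n.
  apply: IH => //.
    have lt : (#|~: active a (vadd x (vscale t b))| < #|~: active a x|)%N.
      by apply: proper_card; rewrite properC.
    exact: leq_trans lt xk.
  move=> v Kv x'v; have xv := subset_trans (proper_sub xx') x'v.
  rewrite matmul_add matmul_scale dot_addl dot_scalel.
  by have := Mx v Kv xv; have := Mb v Kv xv; nra.
(* Two nonpositive terms sum to zero, so both vanish. *)
have : dot (matmul M (vadd x (vscale t b))) u = 0 by rewrite x'0 matmul0 dot0l.
rewrite matmul_add matmul_scale dot_addl dot_scalel.
by have := Mx u Ku xu; have := Mb u Ku xu; nra.
Qed.

End RegularCone.

Unset Implicit Arguments.

Theorem mainTheorem13 (n m : nat) (a : 'I_m -> vec n) (M : 'I_n -> 'I_n -> R) :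
  (exists kappa eps : R, 0 < kappa /\ 0 < eps /\
     forall x y : vec n, norm x < eps -> norm y < eps ->
       er_le (vdist x (fun u => Phi (polycone a) M u y))
             (er_scale kappa (vdist y (Phi (polycone a) M x)))) ->
  forall v : vec n,
    ((exists x, polycone a x /\ v = matmul M x) /\ polar (polycone a) v) <-> v = @vzero n.
Proof.
move=> [kappa [eps [kappa0 [eps0 reg]]]] v.
have lip := regular_homogeneous kappa0 eps0 reg.
split=> [[[x [Kx ->]] Pv]|->].
  (* Polarity gives nonpositivity on all of [K], hence on the face of [x]. *)
  rewrite (copositive_face_trivial kappa0 lip Kx) ?matmul0 // => u Ku _.
  exact: Pv.
split; last by move=> u _; rewrite dot0l; lra.
by exists (@vzero n); split; [apply: polycone0|rewrite matmul0].
Qed.
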